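(* For every $\lambda>0$, $(\mathfrak g_4,S_1^\lambda,J)$ is not a second kind algebraic Ricci soliton associated to $\nabla^1$: there do not exist $c\in\mathbb R$ and a derivation $D$ of $\mathfrak g_4$ such that $\widetilde{\operatorname{Ric}}^1=c\operatorname{Id}+D$.
   Context: $\mathfrak g_4$ is the real Lie algebra with basis $e_1,e_2,e_3,e_4$ and non-zero brackets (up to skew-symmetry) $[e_1,e_2]=e_3$, $[e_1,e_3]=e_4$. For $\lambda>0$, $S_1^\lambda$ is the Lorentzian inner product $\langle\cdot,\cdot\rangle$ on $\mathfrak g_4$ whose matrix in $(e_1,e_2,e_3,e_4)$ is $\begin{bmatrix}1&0&0&0\\0&0&0&1\\0&0&\lambda&0\\0&1&0&0\end{bmatrix}$. Fix the basis $v_1=e_1$, $v_2=\frac1{\sqrt\lambda}e_3$, $v_3=\frac1{\sqrt2}(e_2+e_4)$, $v_4=\frac1{\sqrt2}(e_2-e_4)$, which is orthonormal: $\langle v_i,v_j\rangle=0$ for $i\ne j$, $\langle v_i,v_i\rangle=1$ for $i=1,2,3$, $\langle v_4,v_4\rangle=-1$. The product structure $J$ is the linear map with $Jv_i=v_i$ for $i=1,2,3$ and $Jv_4=-v_4$. Write $\mathfrak g$ for the Lie algebra. The Levi-Civita connection is the bilinear map $\nabla:\mathfrak g\times\mathfrak g\to\mathfrak g$ with $2\langle\nabla_uv,w\rangle=\langle[u,v],w\rangle+\langle[w,u],v\rangle+\langle[w,v],u\rangle$ for all $u,v,w$. Put $(\nabla_uJ)v=\nabla_u(Jv)-J(\nabla_uv)$.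 The canonical connection is $\nabla^0_uv=\nabla_uv-\frac12(\nabla_uJ)Jv$, and the Kobayashi-Nomizu connection is $\nabla^1_uv=\nabla^0_uv-\frac14\left[(\nabla_vJ)Ju-(\nabla_{Jv}J)u\right]$. The curvature of $\nabla^1$ is $R^1_{uv}w=\nabla^1_{[u,v]}w-\nabla^1_u\nabla^1_vw+\nabla^1_v\nabla^1_uw$, its Ricci operator is $\operatorname{Ric}^1(u)=\sum_{k=1}^4\langle v_k,v_k\rangle R^1_{v_ku}v_k$, and $\rho^1(u,v)=\langle\operatorname{Ric}^1(u),v\rangle$. Put $\widetilde\rho^1(u,v)=\frac12(\rho^1(u,v)+\rho^1(v,u))$ and define $\widetilde{\operatorname{Ric}}^1$ by $\langle\widetilde{\operatorname{Ric}}^1(u),v\rangle=\widetilde\rho^1(u,v)$. A derivation of $\mathfrak g$ is a linear map $D:\mathfrak g\to\mathfrak g$ with $[D(u),v]+[u,D(v)]=D[u,v]$ for all $u,v\in\mathfrak g$. *)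

(* Defs.v *)
From mathcomp Require Import all_boot all_order all_algebra.
From mathcomp Require boolp.
From mathcomp Require Import reals.
From mathcomp Require Import ring.

Set Implicit Arguments.
Unset Strict Implicit.
Unset Printing Implicit Defensive.

Import Order.TTheory GRing.Theory Num.Theory.
Local Open Scope ring_scope.

(* Indices are shifted by one: the coordinates of u along e1, e2, e3, e4 are
   u 0 0, u 0 1, u 0 2, u 0 3. *)
Notation g4 R := 'rV[R]_4.

Definition e1 (R : realType) : g4 R := delta_mx 0 0.
Definition e2 (R : realType) : g4 R := delta_mx 0 1.
Definition e3 (R : realType) : g4 R := delta_mx 0 2.
Definition e4 (R : realType) : g4 R := delta_mx 0 3.
Arguments e1 {R}.
Arguments e2 {R}.
Arguments e3 {R}.
Arguments e4 {R}.

(* The bilinear alternating extension of [e1, e2] = e3, [e1, e3] = e4; see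
   [bracketE] and [bracket_lie] below. *)
Definition bracket (R : realType) (u v : g4 R) : g4 R :=
  (u 0 0 * v 0 1 - u 0 1 * v 0 0) *: e3
  + (u 0 0 * v 0 2 - u 0 2 * v 0 0) *: e4.

Definition S1 (R : realType) (lam : R) : 'M[R]_4 :=
  \matrix_(i < 4, j < 4)
    nth 0 (nth [::] [:: [:: 1; 0; 0; 0];
                        [:: 0; 0; 0; 1];
                        [:: 0; 0; lam; 0];
                        [:: 0; 1; 0; 0]] i) j.

Definition form (R : realType) (lam : R) (u v : g4 R) : R :=
  (u *m S1 lam *m v^T) 0 0.

(* v_{i+1} of the orthonormal basis. *)
Definition vb (R : realType) (lam : R) (i : 'I_4) : g4 R :=
  nth 0 [:: e1;
            (Num.sqrt lam)^-1 *: e3;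
            (Num.sqrt 2)^-1 *: (e2 + e4);
            (Num.sqrt 2)^-1 *: (e2 - e4)] i.

Definition is_product_structure (R : realType) (lam : R)
    (J : {linear g4 R -> g4 R}) : Prop :=
  [/\ J (vb lam 0) = vb lam 0, J (vb lam 1) = vb lam 1,
      J (vb lam 2) = vb lam 2 & J (vb lam 3) = - vb lam 3].

Definition is_levi_civita (R : realType) (lam : R)
    (nabla : g4 R -> g4 R -> g4 R) : Prop :=
  [/\ forall u, linear (nabla u),
      forall v, linear (nabla ^~ v) &
      forall u v w,
        2 * form lam (nabla u v) w
        = form lam (bracket u v) w + form lam (bracket w u) v
          + form lam (bracket w v) u].

Definition covJ (R : realType) (nabla : g4 R -> g4 R -> g4 R)
    (J : g4 R -> g4 R) (u v : g4 R) : g4 R :=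
  nabla u (J v) - J (nabla u v).

Definition canonical_connection (R : realType)
    (nabla : g4 R -> g4 R -> g4 R) (J : g4 R -> g4 R) (u v : g4 R) : g4 R :=
  nabla u v - 2^-1 *: covJ nabla J u (J v).

Definition kobayashi_nomizu_connection (R : realType)
    (nabla : g4 R -> g4 R -> g4 R) (J : g4 R -> g4 R) (u v : g4 R) : g4 R :=
  canonical_connection nabla J u v
  - 4^-1 *: (covJ nabla J v (J u) - covJ nabla J (J v) u).

Definition curvature (R : realType) (conn : g4 R -> g4 R -> g4 R)
    (u v w : g4 R) : g4 R :=
  conn (bracket u v) w - conn u (conn v w) + conn v (conn u w).

Definition Ric (R : realType) (lam : R) (conn : g4 R -> g4 R -> g4 R)
    (u : g4 R) : g4 R :=
  \sum_(k < 4) form lam (vb lam k) (vb lam k)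
               *: curvature conn (vb lam k) u (vb lam k).

Definition ricci (R : realType) (lam : R) (conn : g4 R -> g4 R -> g4 R)
    (u v : g4 R) : R :=
  form lam (Ric lam conn u) v.

Definition sym_ricci (R : realType) (lam : R) (conn : g4 R -> g4 R -> g4 R)
    (u v : g4 R) : R :=
  2^-1 * (ricci lam conn u v + ricci lam conn v u).

Definition is_sym_Ric (R : realType) (lam : R)
    (conn : g4 R -> g4 R -> g4 R) (T : g4 R -> g4 R) : Prop :=
  forall u v, form lam (T u) v = sym_ricci lam conn u v.

Definition derivation (R : realType) (D : {linear g4 R -> g4 R}) : Prop :=
  forall u v, bracket (D u) v + bracket u (D v) = D (bracket u v).

(* [is_product_structure] determines J because the vb are a basis, and
   [is_levi_civita] and [is_sym_Ric] determine nabla and the symmetrized Ricci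
   operator by [form_nondegenerate]; that such operators exist is shown in
   [product_structure_exists], [levi_civita_exists] and [sym_Ric_exists]. *)

Lemma row4P (R : realType) (u v : g4 R) :
  u 0 0 = v 0 0 -> u 0 1 = v 0 1 -> u 0 2 = v 0 2 -> u 0 3 = v 0 3 -> u = v.
Proof.
move=> h0 h1 h2 h3; apply/rowP=> -[[|[|[|[|//]]]] i].
- by rewrite [Ordinal i](_ : _ = 0) //; apply/val_inj.
- by rewrite [Ordinal i](_ : _ = 1) //; apply/val_inj.
- by rewrite [Ordinal i](_ : _ = 2) //; apply/val_inj.
- by rewrite [Ordinal i](_ : _ = 3) //; apply/val_inj.
Qed.

Lemma formE (R : realType) (lam : R) (u v : g4 R) :
  form lam u v = u 0 0 * v 0 0 + u 0 1 * v 0 3 + lam * (u 0 2 * v 0 2)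
                 + u 0 3 * v 0 1.
Proof.
rewrite /form !mxE !big_ord_recl !big_ord0 !mxE.
rewrite !big_ord_recl !big_ord0 !mxE /=.
set c1 := lift _ _; have -> : c1 = 1 by apply/val_inj.
set c2 := lift _ _; have -> : c2 = 2 by apply/val_inj.
set c3 := lift _ _; have -> : c3 = 3 by apply/val_inj.
ring.
Qed.

Lemma bracketE (R : realType) :
  (bracket e1 e2 = e3 :> g4 R /\ bracket e1 e3 = e4 :> g4 R) /\
  [/\ bracket e1 e4 = 0 :> g4 R, bracket e2 e3 = 0 :> g4 R,
      bracket e2 e4 = 0 :> g4 R & bracket e3 e4 = 0 :> g4 R].
Proof. by split; split; apply: row4P; rewrite !mxE /=; ring. Qed.

Lemma bracket_lie (R : realType) :
  [/\ forall u : g4 R, linear (bracket u),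
      forall v : g4 R, linear (@bracket R ^~ v),
      forall u : g4 R, bracket u u = 0 &
      forall u v w : g4 R,
        bracket u (bracket v w) + bracket v (bracket w u)
        + bracket w (bracket u v) = 0].
Proof.
by split=> [u a v w|v a u w|u|u v w]; apply: row4P; rewrite !mxE /=; ring.
Qed.

Lemma vb_orthonormal (R : realType) (lam : R) : 0 < lam ->
  forall i j, form lam (vb lam i) (vb lam j)
              = if i != j then 0 else if i == 3 then -1 else 1.
Proof.
move=> hlam.
have hl : (Num.sqrt lam)^-1 * (Num.sqrt lam)^-1 = lam^-1.
  by rewrite -invfM -expr2 sqr_sqrtr // ltW.
have h2 : (Num.sqrt 2)^-1 * (Num.sqrt 2)^-1 = 2^-1 :> R.
  by rewrite -invfM -expr2 sqr_sqrtr // ler0n.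
have hl0 : lam != 0 by rewrite gt_eqF.
move=> -[[|[|[|[|//]]]] i] [[|[|[|[|//]]]] j];
  rewrite formE /vb !mxE /=;
  rewrite ?(mulr0, mul0r, addr0, add0r, mulr1, mul1r, oppr0);
  rewrite ?(mulr1, mulrN, mulNr, opprK, hl, h2, mulr0, mul0r, addr0, add0r, oppr0);
  rewrite ?divff //; by field.
Qed.

Lemma form_nondegenerate (R : realType) (lam : R) (u v : g4 R) : 0 < lam ->
  (forall w, form lam u w = form lam v w) -> u = v.
Proof.
move=> hlam h.
have hl0 : lam != 0 by rewrite gt_eqF.
have := h e1; have := h e2; have := h e3; have := h e4.
rewrite !formE !mxE /= ?(mulr0, mul0r, addr0, add0r, mulr1).
move=> h1 /(mulfI hl0) h2 h3 h0.
exact: row4P.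
Qed.

Lemma product_structure_exists (R : realType) :
  exists J : {linear g4 R -> g4 R},
    forall lam : R, is_product_structure lam J.
Proof.
exists (mulmxr (S1 1)) => lam; rewrite /is_product_structure.
have E (u : g4 R) : mulmxr (S1 1) u
    = u 0 0 *: e1 + u 0 3 *: e2 + u 0 2 *: e3 + u 0 1 *: e4.
  apply: row4P; rewrite /= !mxE !big_ord_recl big_ord0 !mxE /=;
  (set c1 := lift _ _; have -> : c1 = 1 by apply/val_inj);
  (set c2 := lift _ _; have -> : c2 = 2 by apply/val_inj);
  (set c3 := lift _ _; have -> : c3 = 3 by apply/val_inj); ring.
by split; apply: (etrans (E _)); apply: row4P; rewrite !mxE /=; ring.
Qed.

Lemma form_represents (R : realType) (lam : R) (f : g4 R -> R) :
  0 < lam -> (forall a u v, f (a *: u + v) = a * f u + f v) ->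
  exists x, forall w, form lam x w = f w.
Proof.
move=> hlam hf.
have hl0 : lam != 0 by rewrite gt_eqF.
exists (f e1 *: e1 + f e4 *: e2 + (f e3 / lam) *: e3 + f e2 *: e4) => w.
have hw : w = w 0 0 *: e1 + (w 0 1 *: e2 + (w 0 2 *: e3 + (w 0 3 *: e4 + 0))).
  by apply: row4P; rewrite !mxE /=; ring.
have f0 : f 0 = 0.
  by have := hf (-1) 0 0; rewrite scaler0 addr0 mulN1r addNr.
rewrite [in RHS]hw !hf f0 formE !mxE /=; field.
by [].
Qed.

Lemma form_linearl (R : realType) (lam a : R) (x y w : g4 R) :
  form lam (a *: x + y) w = a * form lam x w + form lam y w.
Proof. by rewrite !formE !mxE; ring. Qed.

Lemma form_linearr (R : realType) (lam a : R) (w x y : g4 R) :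
  form lam w (a *: x + y) = a * form lam w x + form lam w y.
Proof. by rewrite !formE !mxE; ring. Qed.

Lemma levi_civita_exists (R : realType) (lam : R) : 0 < lam ->
  exists nabla, is_levi_civita lam nabla.
Proof.
move=> hlam.
pose K (u v w : g4 R) := 2^-1 * (form lam (bracket u v) w
  + form lam (bracket w u) v + form lam (bracket w v) u).
have [hr hl _ _] := bracket_lie R.
have brr a (u x y : g4 R) :
  bracket u (a *: x + y) = a *: bracket u x + bracket u y := hr u a x y.
have brl a (v x y : g4 R) :
  bracket (a *: x + y) v = a *: bracket x v + bracket y v := hl v a x y.
have hK u v : exists x, forall w, form lam x w = K u v w.
  apply: form_represents => // a x y.
  by rewrite /K ?brr ?brl !form_linearl !form_linearr; ring.
have [n hn] := boolp.choice (fun p : g4 R * g4 R => hK p.1 p.2).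
have {}hn u v w : form lam (n (u, v)) w = K u v w := hn (u, v) w.
exists (fun u v => n (u, v)); split=> [u a x y|v a x y|u v w].
- apply: (form_nondegenerate hlam) => w.
  by rewrite form_linearl !hn /K ?brr ?brl !form_linearl !form_linearr; ring.
- apply: (form_nondegenerate hlam) => w.
  by rewrite form_linearl !hn /K ?brr ?brl !form_linearl !form_linearr; ring.
- by rewrite hn /K mulrA divff ?mul1r // pnatr_eq0.
Qed.

Lemma sym_Ric_exists (R : realType) (lam : R)
    (nabla : g4 R -> g4 R -> g4 R) (J : {linear g4 R -> g4 R}) :
  0 < lam -> is_levi_civita lam nabla ->
  exists T, is_sym_Ric lam (kobayashi_nomizu_connection nabla J) T.
Proof.
move=> hlam [hr hl _].
set conn := kobayashi_nomizu_connection nabla J.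
pose lin (f : g4 R -> g4 R) := linear f.
have linD f g : lin f -> lin g -> lin (fun x => f x + g x).
  by move=> hf hg a x y; rewrite hf hg scalerDr addrACA.
have linZ c f : lin f -> lin (fun x => c *: f x).
  by move=> hf a x y; rewrite hf scalerDr !scalerA mulrC.
have linB f g : lin f -> lin g -> lin (fun x => f x - g x).
  move=> hf hg; apply: linD => // a x y.
  by rewrite hg opprD scalerN.
have linC f g : lin f -> lin g -> lin (fun x => f (g x)).
  by move=> hf hg a x y; rewrite hg hf.
have linJ : lin J by move=> a x y; rewrite linearP.
have covr u : lin (covJ nabla J u).
  by apply: linB; apply: linC => //; apply: hr.
have covl v : lin (covJ nabla J ^~ v).
  apply: linB; first exact: hl.
  by apply: (linC J) => //; apply: hl.
have connr u : lin (conn u).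
  apply: (linB (canonical_connection nabla J u)
    (fun v => 4^-1 *: (covJ nabla J v (J u) - covJ nabla J (J v) u))).
    apply: linB; first exact: hr.
    by apply: linZ; apply: (linC (covJ nabla J u)).
  apply: linZ; apply: linB; first exact: covl.
  by apply: (linC (covJ nabla J ^~ u)).
have connl v : lin (conn ^~ v).
  apply: (linB (canonical_connection nabla J ^~ v)
    (fun u => 4^-1 *: (covJ nabla J v (J u) - covJ nabla J (J v) u))).
    apply: linB; first exact: hl.
    by apply: linZ; apply: covl.
  apply: linZ; apply: linB; last exact: covr.
  by apply: (linC (covJ nabla J v)).
have [brr _ _ _] := bracket_lie R.
have linR : lin (Ric lam conn).
  move=> a x y; rewrite /Ric scaler_sumr -big_split /=.
  apply: eq_bigr => k _.
  set c := form _ _ _; set z := vb _ _.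
  suff h : lin (fun u => c *: curvature conn z u z) by exact: (h a x y).
  apply: linZ; apply: linD; last first.
    exact: (connl (conn z z)).
  apply: linB; first exact: (linC (conn ^~ z) (bracket z) (connl z) (brr z)).
  exact: (linC (conn z) (conn ^~ z) (connr z) (connl z)).
have h u : exists x, forall w, form lam x w = sym_ricci lam conn u w.
  apply: form_represents => // a x y.
  have alg (p q r s : R) : 2^-1 * (a * p + q + (a * r + s))
      = a * (2^-1 * (p + r)) + 2^-1 * (q + s) by ring.
  by rewrite /sym_ricci /ricci linR form_linearl form_linearr alg.
by have [T hT] := boolp.choice h; exists T.
Qed.

(* Main.v *)
(* For a derivation D, the vector D e4 = [D e1, e3] + [e1, D e3] has no e2
   component, and neither has c e4.  But e4 is the isotropic vector dual to e2,
   so the e2 component of T e4 is rho^1(e4, e4), which equals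
   (lam^2 + 1) / (8 lam) and hence never vanishes. *)
Require Import Defs.
From mathcomp Require Import all_boot all_order all_algebra.
From mathcomp Require Import reals.
From mathcomp Require Import ring.

Import Order.TTheory GRing.Theory Num.Theory.
Local Open Scope ring_scope.

Lemma row4_basis (R : realType) (u : g4 R) :
  u = u 0 0 *: e1 + u 0 1 *: e2 + u 0 2 *: e3 + u 0 3 *: e4.
Proof. by apply: row4P; rewrite !mxE /=; ring. Qed.

Section Structure.

Variables (R : realType) (lam : R).
Hypothesis lam_gt0 : 0 < lam.

(** The scalars in the orthonormal basis are nonzero, so [J] fixes [e1], [e3] and [e2 + e4] and
    negates [e2 - e4]: it swaps [e2] and [e4]. *)
Lemma product_structureE (J : {linear g4 R -> g4 R}) :
  is_product_structure lam J ->
  forall u, [/\ J u 0 0 = u 0 0, J u 0 1 = u 0 3, J u 0 2 = u 0 2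
    & J u 0 3 = u 0 1].
Proof.
case; rewrite /vb /= => J1 J3 Jp Jm u.
have sq2 : (Num.sqrt 2)^-1 != 0 :> R by rewrite invr_eq0 sqrtr_eq0 -ltNge ltr0n.
have sql : (Num.sqrt lam)^-1 != 0 by rewrite invr_eq0 sqrtr_eq0 -ltNge.
move: J3 Jp Jm; rewrite !linearZ_LR /= => /(scalerI sql) J3 /(scalerI sq2).
rewrite raddfD => Jp /(scalerI sq2); rewrite raddfB => Jm.
have two0 : (2 : R) != 0 by rewrite pnatr_eq0.
(* Adding [Jp] and [Jm] cancels [J e4] and leaves twice the claim. *)
have J2 : J e2 = e4.
  apply: (scalerI two0); rewrite !scaler_nat !mulr2n.
  have -> : J e2 + J e2 = (J e2 + J e4) + (J e2 - J e4) by rewrite addrACA addrN addr0.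
  by rewrite Jp Jm opprB addrC addrA subrK.
have J4 : J e4 = e2 by apply: (addrI (J e2)); rewrite Jp J2 addrC.
rewrite (row4_basis _ u) !raddfD /= !linearZ_LR /= J1 J2 J3 J4.
by split; rewrite !mxE /=; ring.
Qed.

(** Koszul's formula is tested on the basis; since [e2] and [e4] are dual to each other, pairing
    with one reads the coordinate along the other. The [e2] coordinate vanishes because [e4] is
    central and orthogonal to all brackets. *)
Lemma levi_civitaE (nabla : g4 R -> g4 R -> g4 R) :
  is_levi_civita lam nabla -> forall u v,
  [/\ nabla u v 0 0 = (1 + lam) / 2 * (u 0 1 * v 0 2 + u 0 2 * v 0 1),
      nabla u v 0 1 = 0,
      nabla u v 0 2 = (lam * (u 0 0 * v 0 1 - u 0 1 * v 0 0)
                       - u 0 0 * v 0 1 - u 0 1 * v 0 0) / (2 * lam)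
    & nabla u v 0 3 = (u 0 0 * v 0 2 - u 0 2 * v 0 0
                       - lam * (u 0 0 * v 0 2 + u 0 2 * v 0 0)) / 2].
Proof.
case=> _ _ koszul u v.
have two0 : (2 : R) != 0 by rewrite pnatr_eq0.
have lam0 : lam != 0 by rewrite gt_eqF.
have K w : Defs.form lam (nabla u v) w = (Defs.form lam (bracket u v) w
    + Defs.form lam (bracket w u) v + Defs.form lam (bracket w v) u) / 2.
  by rewrite -koszul mulrC mulKf.
have := K e1; have := K e2; have := K e3; have := K e4.
rewrite !formE !mxE /= ?(mulr0, mul0r, addr0, add0r, mulr1).
(* [N2] comes from [e3], of square norm [lam], so a factor [lam] has to be cancelled. *)
move=> -> N2 -> ->; split; try by field.
by apply: (mulfI lam0); rewrite N2; field.
Qed.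

(** The shape reflects [J]: values have equal [e2] and [e4] coordinates, so they lie in its +1
    eigenspace, and [v] enters only through its projection there, so [K u] kills [e2 - e4]. *)
Lemma kobayashi_nomizuE (J : {linear g4 R -> g4 R})
    (nabla : g4 R -> g4 R -> g4 R) (K := kobayashi_nomizu_connection nabla J) :
  is_product_structure lam J -> is_levi_civita lam nabla -> forall u v,
  [/\ K u v 0 0 = (1 + lam) / 4
                  * ((u 0 1 + u 0 3) * v 0 2 + u 0 2 * (v 0 1 + v 0 3)),
      K u v 0 1 = (1 - lam) / 4 * (u 0 0 * v 0 2)
                  - (1 + lam) / 4 * (u 0 2 * v 0 0),
      K u v 0 2 = (lam - 1) / (4 * lam)
                  * (u 0 0 * (v 0 1 + v 0 3) + u 0 3 * v 0 0)
                  - (1 + 3 * lam) / (4 * lam) * (u 0 1 * v 0 0)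
    & K u v 0 3 = K u v 0 1].
Proof.
move=> hJ hnabla u v.
have lam0 : lam != 0 by rewrite gt_eqF.
have J0 w : J w 0 0 = w 0 0 by case: (product_structureE _ hJ w).
have J1 w : J w 0 1 = w 0 3 by case: (product_structureE _ hJ w).
have J2 w : J w 0 2 = w 0 2 by case: (product_structureE _ hJ w).
have J3 w : J w 0 3 = w 0 1 by case: (product_structureE _ hJ w).
have N0 x y := let: And4 E _ _ _ := levi_civitaE _ hnabla x y in E.
have N1 x y := let: And4 _ E _ _ := levi_civitaE _ hnabla x y in E.
have N2 x y := let: And4 _ _ E _ := levi_civitaE _ hnabla x y in E.
have N3 x y := let: And4 _ _ _ E := levi_civitaE _ hnabla x y in E.
rewrite /K /kobayashi_nomizu_connection /canonical_connection /covJ.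
by split; rewrite !mxE /= ?(J0, J1, J2, J3) ?(N0, N1, N2, N3)
  ?(J0, J1, J2, J3); field.
Qed.

Lemma ricci_e4e4 (J : {linear g4 R -> g4 R}) (nabla : g4 R -> g4 R -> g4 R) :
  is_product_structure lam J -> is_levi_civita lam nabla ->
  ricci lam (kobayashi_nomizu_connection nabla J) e4 e4
  = (lam ^+ 2 + 1) / (8 * lam).
Proof.
move=> hJ hnabla.
have lam0 : lam != 0 by rewrite gt_eqF.
rewrite /ricci.
move: (kobayashi_nomizuE _ _ hJ hnabla).
set K := kobayashi_nomizu_connection nabla J; move: K => K KE.
have K0 x y := let: And4 E _ _ _ := KE x y in E.
have K1 x y := let: And4 _ E _ _ := KE x y in E.
have K2 x y := let: And4 _ _ E _ := KE x y in E.
rewrite /Ric !big_ord_recl big_ord0 !vb_orthonormal //=.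
(* Only the [e2] coordinate of the curvature matters, and by [K1] that of [K u v] vanishes when [u]
   has no [e1] or [e3] component. *)
have -> x : Defs.form lam x e4 = x 0 1 by rewrite formE !mxE /=; ring.
rewrite /curvature !mxE.
rewrite ?(K0, K1, K2).
rewrite /vb !mxE /=.
have : (Num.sqrt lam)^-1 ^+ 2 = lam^-1 by rewrite exprVn sqr_sqrtr // ltW.
set s := (Num.sqrt lam)^-1; set t := (Num.sqrt 2)^-1 => s2.
(* The summands come from [e1] and [s *: e3]; the two basis vectors in the span of [e2] and [e4]
   contribute nothing. *)
transitivity ((lam - 1) ^+ 2 / (16 * lam) + s ^+ 2 * (1 + lam) ^+ 2 / 16).
  by field.
by rewrite s2; field.
Qed.

End Structure.

(** All brackets lie in the span of [e3] and [e4]. *)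
Lemma derivation_e4 (R : realType) (D : {linear g4 R -> g4 R}) :
  derivation D -> D e4 0 1 = 0.
Proof.
move=> derD; have [[_ <-] _] := bracketE R.
by rewrite -derD !mxE /=; ring.
Qed.

Theorem theorem3p6 (R : realType) (lam : R) (hlam : 0 < lam)
    (J : {linear g4 R -> g4 R}) (hJ : is_product_structure lam J)
    (nabla : g4 R -> g4 R -> g4 R) (hnabla : is_levi_civita lam nabla)
    (T : g4 R -> g4 R)
    (hT : is_sym_Ric lam (kobayashi_nomizu_connection nabla J) T) :
  ~ exists (c : R) (D : {linear g4 R -> g4 R}),
      derivation D /\ forall u : g4 R, T u = c *: u + D u.
Proof.
case=> c [D [derD TE]].
have lam0 : lam != 0 by rewrite gt_eqF.
(* On the diagonal symmetrization changes nothing, so a vanishing left side contradicts the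
   positivity of [ricci_e4e4]. *)
have := hT e4 e4; rewrite /sym_ricci (ricci_e4e4 _ _ hlam _ _ hJ hnabla).
have -> : Defs.form lam (T e4) e4 = 0.
  by rewrite TE formE !mxE /= derivation_e4 //; ring.
have -> : 2^-1 * ((lam ^+ 2 + 1) / (8 * lam) + (lam ^+ 2 + 1) / (8 * lam))
    = (lam ^+ 2 + 1) / (8 * lam) by field.
apply/eqP; rewrite eq_sym gt_eqF // divr_gt0 ?mulr_gt0 ?ltr0n //.
by rewrite ltr_wpDl ?sqr_ge0 ?ltr01.
Qed.
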